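(* Let $r=r(n)\ge3$, $m=m(n)$ and $k=k(n)$ be integers with $m=o(r^{-3}n^{3/2})$ and $k=o\bigl(\frac{n^3}{r^6m^2}\bigr)$. Let $K=K(n)$ be a linear $r$-graph on $[n]$ with $k$ edges, and let $H$ be chosen uniformly at random from $\mathcal{L}_r(n,m)$. Then, as $n\to\infty$, \[ \mathbb{P}[K\subseteq H]=\frac{[m]_k}{N^k}\exp\Bigl[\frac{[r]_2^2k^2}{4n^2}+O\Bigl(\frac{r^4k}{n^2}+\min\Bigl\{\frac{r^6m^2k}{n^3},\frac{r^5mk}{n^2}\Bigr\}\Bigr)\Bigr]. \]
   Context: An $r$-graph on $[n]$ is a set of $r$-subsets of $[n]$ (edges); it is linear if any two distinct edges share at most one vertex. $\mathcal{L}_r(n,m)$ is the set of linear $r$-graphs on $[n]$ with exactly $m$ edges. $K\subseteq H$ means every edge of $K$ is an edge of $H$. $N=\binom nr$, $[x]_t=x(x-1)\cdots(x-t+1)$. *)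

(* Defs.v *)
From HB Require Import structures.
From mathcomp Require Import all_boot.
From Stdlib Require Import Reals.

Definition is_rgraph (n r : nat) (H : {set {set 'I_n}}) : bool :=
  [forall e in H, #|e| == r].

Definition is_linear (n : nat) (H : {set {set 'I_n}}) : bool :=
  [forall e in H, forall f in H, (e != f) ==> (#|e :&: f| <= 1)].

Definition Lr (n r m : nat) : {set {set {set 'I_n}}} :=
  [set H | [&& is_rgraph n r H, is_linear n H & #|H| == m]].

Definition prob_contained (n r m : nat) (K : {set {set 'I_n}}) : R :=
  (INR #|[set H in Lr n r m | K \subset H]| / INR #|Lr n r m|)%R.

Definition ffall (x t : nat) : nat := falling_factorial x t.

(* Main.v *)
Require Import Defs.
From Stdlib Require Import Reals Lra Psatz.
From HB Require Import structures.
From mathcomp Require Import all_boot.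
From mathcomp Require Import zify.

Set Implicit Arguments.
Unset Strict Implicit.
Unset Printing Implicit Defensive.

(** Embed the edges of [K] one at a time. For a linear [S] with [s < m] edges, let
[L(S, j)] be the number of linear [r]-graphs with [j] edges containing [S]. Double
counting the pairs (a graph, a further edge of it) expresses [(m - s) L(S, m)] as the sum, over the
graphs [G] counted by [L(S, m - 1)], of the number of [r]-sets meeting every edge of [G]
in at most one vertex, while [L(S + e, m)] counts those [G] compatible with the new
edge [e]. With [N] the number of [r]-sets and [y] the proportion of them meeting a given
[r]-set in at least two vertices, the first number is [N (1 - (m - 1) y)] up to second
order. The compatible [G] have density [1 - (m - 1 - s) y] up to second order, by
Bonferroni over the [r]-sets [f] conflicting with [e], crude bounds on
[L(S + f, m - 1) / L(S, m - 1)] being enough. Hence the conditional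
probability of [e] is [(m - s) / N * exp (s y + error)], where the error is bounded both by
[r^6 m^2 / n^3] and by [r^4 m / n^2], and [y] is [[r]_2^2 / (2 n^2)] to first order.
Multiply over the edges of [K]. *)

(** * Bonferroni inequalities for finite unions *)

Lemma card_sum_in (T : finType) (A B : {set T}) :
  #|A :&: B| = \sum_(x in A) (x \in B).
Proof.
rewrite -sum1_card big_mkcond [RHS]big_mkcond /=.
by apply: eq_bigr => x _; rewrite inE; case: (x \in A); case: (x \in B).
Qed.

(** Compared pointwise: a point in [c >= 1] of the sets contributes [c] on the left and
    [1 + c (c - 1)] on the right. The correction runs over ordered pairs, twice the classical one,
    which costs only a constant. *)
Lemma bonferroni (I T : finType) (P : {set I}) (F : I -> {set T}) :
  \sum_(i in P) #|F i| <=
  #|\bigcup_(i in P) F i| + \sum_(i in P) \sum_(j in P | j != i) #|F i :&: F j|.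
Proof.
have E1 i : #|F i| = \sum_x (x \in F i).
  by rewrite -{1}[F i]setTI card_sum_in; apply: eq_bigl => x; rewrite inE.
have E2 i j : #|F i :&: F j| = \sum_x (x \in F i) * (x \in F j).
  by rewrite -[LHS]cardsE -sum1_card big_mkcond; apply: eq_bigr => x _;
    rewrite !inE; case: (x \in F i); case: (x \in F j).
under eq_bigr do rewrite E1.
rewrite exchange_big /=.
under [X in _ + X]eq_bigr => i _.
  under eq_bigr do rewrite E2.
  rewrite exchange_big /=; over.
rewrite [X in _ + X]exchange_big /= -[\bigcup_(i in P) _]setTI card_sum_in.
rewrite [X in _ <= X + _](eq_bigl xpredT); last by move=> x; rewrite inE.
rewrite -big_split /=; apply: leq_sum => x _.
case: (boolP (x \in \bigcup_(i in P) F i)) => [|nx]; last first.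
  rewrite big1 // => i Pi; apply/eqP; rewrite eqb0; apply: contra nx => xi.
  by apply/bigcupP; exists i.
case/bigcupP=> i Pi xi.
rewrite (bigD1 i) //= xi leq_add2l [X in _ <= X](bigD1 i) //= xi.
apply: leq_trans (leq_addr _ _); apply: leq_sum => j _.
by rewrite mul1n.
Qed.

Lemma card_bigcup_leq (I T : finType) (P : {set I}) (F : I -> {set T}) :
  #|\bigcup_(i in P) F i| <= \sum_(i in P) #|F i|.
Proof.
elim/big_rec2: _ => [|i s A _ IH]; first by rewrite cards0.
by rewrite cardsU; apply: leq_trans (leq_subr _ _) _; rewrite leq_add2l.
Qed.

(** * Conflicting, free and blocked edges *)

Section Counting.
Variables n r : nat.
Implicit Types (e f g A : {set 'I_n}) (G H S : {set {set 'I_n}}).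

Definition rsets : {set {set 'I_n}} := [set e : {set 'I_n} | #|e| == r].
Definition conflicts e : {set {set 'I_n}} := [set f in rsets | 1 < #|f :&: e|].
(** The test includes [f = e]: for [r > 1] an edge of [G] meets itself in too many vertices, so free
    sets are automatically new edges. *)
Definition free G : {set {set 'I_n}} :=
  [set e in rsets | [forall f in G, #|e :&: f| <= 1]].
Definition ext S m : {set {set {set 'I_n}}} := [set H in Lr n r m | S \subset H].

Lemma card_rsets : #|rsets| = 'C(n, r).
Proof. by rewrite card_draws card_ord. Qed.

Lemma freeP G e :
  reflect (#|e| = r /\ forall f, f \in G -> #|e :&: f| <= 1) (e \in free G).
Proof.
rewrite !inE; apply: (iffP andP) => -[/eqP er eG]; split=> //; try exact/eqP.
  by move=> f fG; move/forall_inP: eG; apply.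
by apply/forall_inP.
Qed.

Lemma LrP m H :
  reflect [/\ forall e, e \in H -> #|e| = r,
     forall e f, e \in H -> f \in H -> e != f -> #|e :&: f| <= 1 & #|H| = m]
    (H \in Lr n r m).
Proof.
rewrite inE; apply: (iffP and3P) => -[Hr Hl Hm]; split.
- by move=> e eH; apply/eqP; move/forall_inP: Hr; apply.
- move=> e f eH fH ef; move/forall_inP: Hl => /(_ _ eH)/forall_inP/(_ _ fH).
  by rewrite ef.
- exact/eqP.
- by apply/forall_inP => e eH; apply/eqP; apply: Hr.
- apply/forall_inP => e eH; apply/forall_inP => f fH; apply/implyP; exact: Hl.
- exact/eqP.
Qed.

Lemma ext_small S m : m < #|S| -> #|ext S m| = 0.
Proof.
move=> mS; apply: eq_card0 => H; rewrite inE; apply/negP => /andP[/LrP[_ _ Hm]].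
by move/subset_leq_card; rewrite Hm leqNgt mS.
Qed.

Lemma ext_id S : S \in Lr n r #|S| -> #|ext S #|S| | = 1.
Proof.
move=> SL; rewrite -(cards1 S); apply: eq_card => H; rewrite !inE.
apply/idP/eqP => [/andP[/and3P[_ _ /eqP HS] SH]|->].
  by apply/eqP; rewrite eq_sym eqEcard SH HS leqnn.
by move: SL; rewrite inE subxx andbT.
Qed.

Lemma free_complement G : {subset G <= rsets} ->
  #|free G| + #|\bigcup_(g in G) conflicts g| = #|rsets|.
Proof.
move=> Gr.
have -> : free G = rsets :\: \bigcup_(g in G) conflicts g.
  apply/setP => e; rewrite in_setD inE andbC; case: (boolP (e \in rsets)) => er; last by rewrite !andbF.
  rewrite !andbT; apply/forall_inP/negP => [eG /bigcupP[g gG]|eG g gG].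
    by rewrite inE => /andP[_]; rewrite ltnNge eG.
  by rewrite leqNgt; apply/negP => c; apply: eG; apply/bigcupP; exists g; rewrite // inE er.
rewrite cardsD (setIidPr _) ?subnK //; last first.
  by apply/bigcupsP => g _; apply/subsetP => f; rewrite inE => /andP[].
apply: subset_leq_card; apply/bigcupsP => g _; apply/subsetP => f.
by rewrite inE => /andP[].
Qed.

Definition blocked e S m := #|[set G in ext S m | e \notin free G]|.

(** If [e] is not free for [G], some edge [f] of [G] meets [e] twice. Since [e] is free for [S],
    this [f] lies outside [S], and linearity of [G], which contains [S], makes [f] free for [S]. *)
Lemma blocked_bigcup e S m : e \in free S ->
  [set G in ext S m | e \notin free G] =
  \bigcup_(f in conflicts e :&: free S) ext (f |: S) m.
Proof.
move=> eS; have /freeP[er eS'] := eS.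
have erR : e \in rsets by rewrite inE er.
apply/setP => G; rewrite inE; apply/andP/bigcupP.
- case=> GE; have := GE; rewrite inE => /andP[/LrP[Gr Gl Gm] SG].
  rewrite inE erR /= => /forall_inPn[f fG]; rewrite -ltnNge => c.
  have fS : f \notin S by apply/negP => /eS'; rewrite leqNgt c.
  have fr : #|f| == r by rewrite Gr.
  exists f.
    rewrite !inE fr setIC c /=; apply/forall_inP => g gS; apply: Gl => //.
      exact: (subsetP SG).
    by apply: contraNneq fS => ->.
  by move: GE; rewrite !inE subUset sub1set fG => /andP[-> ->].
- case=> f; rewrite inE => /andP[fc fF] GE; move: GE.
  rewrite inE subUset sub1set => /and3P[GL fG SG]; split.
    by rewrite inE GL.
  apply/negP => /freeP[_ /(_ _ fG)]; rewrite leqNgt setIC.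
  by move: fc; rewrite inE => /andP[_ ->].
Qed.

Lemma blocked_leq e S m : e \in free S ->
  blocked e S m <= \sum_(f in conflicts e :&: free S) #|ext (f |: S) m|.
Proof. by move=> eS; rewrite /blocked blocked_bigcup // card_bigcup_leq. Qed.

Lemma leq_blocked e S m : e \in free S ->
  \sum_(f in conflicts e :&: free S) #|ext (f |: S) m| <= blocked e S m +
    \sum_(f in conflicts e :&: free S)
      \sum_(g in conflicts e :&: free S | g != f) #|ext (g |: (f |: S)) m|.
Proof.
move=> eS; rewrite /blocked blocked_bigcup //.
apply: leq_trans (bonferroni _ _) _; rewrite leq_add2l.
apply: leq_sum => f _; apply: leq_sum => g _.
apply: subset_leq_card; apply/subsetP => G; rewrite !inE !subUset !sub1set.
by case/andP => /andP[-> /andP[-> ->]] /andP[_ /andP[-> _]].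
Qed.

(** * Counting r-sets through given vertices, and pairs of conflicts *)

Definition supersets A : {set {set 'I_n}} := [set f in rsets | A \subset f].

(* The test matters: for [t > r] truncated subtraction would give [1] instead of [0]. *)
Definition superset_num t := if t <= r then 'C(n - t, r - t) else 0.

Lemma card_supersets A : #|supersets A| = superset_num #|A|.
Proof.
rewrite /superset_num; case: (leqP #|A| r) => Ar; last first.
  apply: eq_card0 => f; rewrite !inE; apply/negP => /andP[/eqP fr].
  by move/subset_leq_card; rewrite fr leqNgt Ar.
have <- : #|~: A| = n - #|A| by rewrite cardsCs setCK card_ord.
rewrite -cards_draws.
have inj : {in supersets A &, injective (fun f => f :\: A)}.
  move=> f g; rewrite !inE => /andP[_ Af] /andP[_ Ag] E.
  by rewrite -(setID f A) -(setID g A) E (setIidPr Af) (setIidPr Ag).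
rewrite -(card_in_imset inj); apply: eq_card => g.
apply/imsetP/idP.
  case=> f; rewrite !inE => /andP[/eqP fr Af] ->.
  by rewrite cardsD (setIidPr Af) fr eqxx andbT setDE subsetIr.
rewrite inE => /andP[gA /eqP gr]; exists (g :|: A).
  rewrite !inE subsetUr andbT cardsU gr.
  have -> : g :&: A = set0 by apply/eqP; rewrite setI_eq0 disjoints_subset.
  by rewrite cards0 subn0 subnK.
rewrite setDUl setDv setU0; apply/esym/setDidPl.
by rewrite disjoints_subset.
Qed.

(** A division-free form of the ratio [[r]_t / [n]_t]. After multiplication by [(r - t)! (n - r)!]
    both sides become [n!]; for [t > r] or [r > n] both vanish. *)
Lemma superset_num_ffact t : t <= n ->
  superset_num t * n ^_ t = 'C(n, r) * r ^_ t.
Proof.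
move=> tn; rewrite /superset_num; case: (leqP t r) => tr; last first.
  by rewrite [r ^_ _]ffact_small // muln0.
have [rn|rn] := leqP r n; last first.
  by rewrite !bin_small //; lia.
have nz : 0 < (r - t)`! * (n - r)`! by rewrite muln_gt0 !fact_gt0.
apply/eqP; rewrite -(eqn_pmul2r nz); apply/eqP.
have E1 : 'C(n - t, r - t) * ((r - t)`! * (n - r)`!) = (n - t)`!.
  by rewrite -(@bin_fact (n - t) (r - t)); [congr (_ * (_ * _`!)); lia | lia].
have := bin_fact rn; have := ffact_fact tn; have := ffact_fact tr.
move=> E2 E3 E4.
transitivity (n`!); first by rewrite -E3 -E1; lia.
by rewrite -E4 -E2; lia.
Qed.

(** Double counting of the pairs of a [t]-subset [A] of [e] and an r-set [f] containing [A]. *)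
Lemma sum_bin_meet e t : \sum_(f in rsets) 'C(#|f :&: e|, t) =
  'C(#|e|, t) * superset_num t.
Proof.
transitivity (\sum_(f in rsets)
    \sum_(A : {set 'I_n} | (A \subset e) && (#|A| == t)) (A \subset f)).
  apply: eq_bigr => f _; rewrite -cards_draws -sum1_card.
  rewrite big_mkcond [RHS]big_mkcond /=; apply: eq_bigr => A _.
  rewrite !inE subsetI; case: (A \subset f); case: (A \subset e) => //=;
   by case: (#|A| == t).
rewrite exchange_big /= -cards_draws -sum_nat_const.
apply: eq_big => [A|A /andP[_ /eqP <-]]; first by rewrite inE.
rewrite -card_supersets -[RHS]sum1_card big_mkcond [RHS]big_mkcond /=.
by apply: eq_bigr => f _; rewrite !inE; case: (#|f| == r); case: (A \subset f).
Qed.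

(** The first-moment count of conflicts with an r-set: a set meeting it in [j] vertices is counted
    ['C(j, 2)] times. Divided by ['C(n, r)] it is the proportion y. *)
Definition conflict_num := 'C(r, 2) * superset_num 2.
(** One quantity for two second-order errors: the overcount in [conflict_num], and the number of
    common conflicts of two edges. *)
Definition conflict_err := r ^ 3 * superset_num 3 + r ^ 4 * superset_num 4.

Lemma conflicts_sum e : #|conflicts e| = \sum_(f in rsets) (1 < #|f :&: e|).
Proof.
rewrite -sum1_card [LHS]big_mkcond [RHS]big_mkcond; apply: eq_bigr => f _.
by rewrite [f \in conflicts e]in_set; case: (f \in rsets); case: (1 < _).
Qed.

Lemma conflicts_leq e : #|e| = r -> #|conflicts e| <= conflict_num.
Proof.
move=> er; rewrite conflicts_sum /conflict_num -er -sum_bin_meet.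
apply: leq_sum => f _; case: (#|f :&: e|) => [|[|j]] //.
by rewrite bin_gt0.
Qed.

Lemma bin2_leq_bin3 j : 'C(j, 2) <= (1 < j) + 2 * 'C(j, 3).
Proof.
case: j => [|[|[|j]]] //; rewrite (binS j.+2 2) (binS j.+2 1) (binS j.+1 1).
rewrite !bin1 /=; lia.
Qed.

(** Only sets meeting [e] in at least three vertices are overcounted. By [bin2_leq_bin3] the excess
    is at most [2 * 'C(r, 3) * superset_num 3], which the cubic term absorbs. *)
Lemma leq_conflicts e : #|e| = r -> conflict_num <= #|conflicts e| + conflict_err.
Proof.
move=> er.
have H : conflict_num <= #|conflicts e| + 2 * ('C(r, 3) * superset_num 3).
  rewrite /conflict_num -er -!sum_bin_meet conflicts_sum big_distrr -big_split /=.
  by apply: leq_sum => f _; apply: bin2_leq_bin3.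
apply: leq_trans H _; rewrite leq_add2l /conflict_err mulnA.
apply: leq_trans (leq_addr _ _); rewrite leq_mul2r; apply/orP; right.
have := bin_ffact r 3; rewrite !ffactnS ffactn0 (_ : 3`! = 6) //.
have : r * (r.-1 * (r.-1.-1 * 1)) <= r ^ 3.
  by rewrite !expnS expn0 !leq_mul //; lia.
lia.
Qed.

(** A common conflict either contains the single common vertex and one further vertex of each edge
    (at most [r ^ 3] triples, [T3]), or avoids it and contains two private vertices of each edge (at
    most [r ^ 4] quadruples, [T4]). *)
Lemma conflictsI_leq e f : #|e| = r -> #|f| = r -> #|e :&: f| <= 1 ->
  #|conflicts e :&: conflicts f| <= conflict_err.
Proof.
move=> er fr ef.
pose T3 := [set x.1.1 |: [set x.1.2; x.2] |
   x in setX (setX (e :&: f) (e :\: f)) (f :\: e)].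
pose D2 (A : {set 'I_n}) := [set p : {set 'I_n} | p \subset A & #|p| == 2].
pose T4 := [set x.1 :|: x.2 | x in setX (D2 (e :\: f)) (D2 (f :\: e))].
have c3 A : A \in T3 -> #|A| = 3.
  case/imsetP=> -[[v a] b]; rewrite !inE /= => /andP[/andP[/andP[ve vf] /andP[af ae]] /andP[be bf]] ->.
  rewrite cardsU1 cards2 !inE negb_or.
  have -> : v != a by apply: contraNneq af => <-.
  have -> : v != b by apply: contraNneq be => <-.
  by have -> : a != b by apply: contraNneq be => <-.
have c4 A : A \in T4 -> #|A| = 4.
  case/imsetP=> -[p q]; rewrite !inE /= => /andP[/andP[pe /eqP p2] /andP[qf /eqP q2]] ->.
  rewrite cardsU p2 q2; suff -> : p :&: q = set0 by rewrite cards0.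
  apply/setP => x; rewrite !inE; apply/negP => /andP[xp xq].
  by have := subsetP pe _ xp; have := subsetP qf _ xq; rewrite !inE => /andP[/negP+ _] /andP[_ ?].
have sub : conflicts e :&: conflicts f \subset
   \bigcup_(A in T3 :|: T4) supersets A.
  apply/subsetP => g; rewrite !inE => /andP[/andP[gr ge] /andP[_ gf]].
  have g1 : #|g :&: e| = #|g :&: (e :&: f)| + #|g :&: (e :\: f)|.
    by rewrite -[LHS](cardsID f) -!setIA setIDA.
  have g2 : #|g :&: f| = #|g :&: (e :&: f)| + #|g :&: (f :\: e)|.
    by rewrite -[LHS](cardsID e) -!setIA setIDA [f :&: e]setIC.
  have [h0|] := posnP #|g :&: (e :&: f)|.
    have /card_gt0P[p] : 0 < #|D2 (g :&: (e :\: f))|.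
      by rewrite cards_draws bin_gt0; lia.
    have /card_gt0P[q] : 0 < #|D2 (g :&: (f :\: e))|.
      by rewrite cards_draws bin_gt0; lia.
    rewrite !inE !subsetI => /andP[/andP[qg qf] q2] /andP[/andP[pg pe] p2].
    apply/bigcupP; exists (p :|: q); last by rewrite !inE gr subUset pg qg.
    rewrite inE; apply/orP; right; apply/imsetP; exists (p, q) => //.
    by rewrite !inE /= pe p2 qf q2.
  move=> h; have : #|g :&: (e :&: f)| <= 1.
    by apply: leq_trans ef; apply: subset_leq_card; apply: subsetIr.
  move=> h1.
  have /card_gt0P[a] : 0 < #|g :&: (e :\: f)| by lia.
  have /card_gt0P[b] : 0 < #|g :&: (f :\: e)| by lia.
  case/card_gt0P: h => v.
  rewrite inE => /andP[vg vef]; rewrite inE => /andP[bg bfe]; rewrite inE => /andP[ag aef].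
  apply/bigcupP; exists (v |: [set a; b]).
    rewrite inE; apply/orP; left; apply/imsetP; exists (v, a, b) => //.
    by rewrite !in_setX vef aef bfe.
  by rewrite !inE gr !subUset !sub1set vg ag bg.
apply: leq_trans (subset_leq_card sub) _.
rewrite bigcup_setU; apply: leq_trans (leq_card_setU _ _) _.
apply: leq_add.
- apply: leq_trans (card_bigcup_leq _ _) _.
  rewrite (eq_bigr (fun=> superset_num 3)); last by move=> A /c3 <-; rewrite card_supersets.
  rewrite sum_nat_const leq_mul2r; apply/orP; right.
  apply: leq_trans (leq_imset_card _ _) _; rewrite !cardsX.
  have := subset_leq_card (subsetIl e f).
  have := subset_leq_card (subsetDl e f); have := subset_leq_card (subsetDl f e).
  rewrite er fr => H1 H2 H3; rewrite !expnS expn0 muln1 mulnA.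
  by apply: leq_mul => //; apply: leq_mul.
- apply: leq_trans (card_bigcup_leq _ _) _.
  rewrite (eq_bigr (fun=> superset_num 4)); last by move=> A /c4 <-; rewrite card_supersets.
  rewrite sum_nat_const leq_mul2r; apply/orP; right.
  apply: leq_trans (leq_imset_card _ _) _; rewrite !cardsX !cards_draws.
  have H (A B : {set 'I_n}) : #|A| = r -> 'C(#|A :\: B|, 2) <= r ^ 2.
    move=> <-; have := subset_leq_card (subsetDl A B).
    by have := bin_ffact #|A :\: B| 2; rewrite !ffactnS ffactn0 (_ : 2`! = 2) // => E1 E2; nia.
  by rewrite (expnD r 2 2) leq_mul ?H.
Qed.

(** * Bounds on the number of free r-sets *)

Lemma free_geq m G : G \in Lr n r m -> 'C(n, r) <= #|free G| + m * conflict_num.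
Proof.
case/LrP=> Gr _ Gm; rewrite -card_rsets -(@free_complement G) => [|g /Gr gr]; last by rewrite inE gr.
rewrite leq_add2l; apply: leq_trans (card_bigcup_leq _ _) _.
by rewrite -Gm -sum_nat_const; apply: leq_sum => g /Gr; apply: conflicts_leq.
Qed.

(** Of the [m ^ 2] error terms, [m] come from replacing each [#|conflicts g|] by [conflict_num], and
    [m (m - 1)] from the ordered pairs of edges in [bonferroni]. *)
Lemma free_leq m G : G \in Lr n r m ->
  #|free G| + m * conflict_num <= 'C(n, r) + m ^ 2 * conflict_err.
Proof.
case/LrP=> Gr Gl Gm; rewrite -card_rsets -(@free_complement G) => [|g /Gr gr]; last by rewrite inE gr.
rewrite -addnA leq_add2l.
have H1 : m * conflict_num <= \sum_(g in G) #|conflicts g| + m * conflict_err.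
  rewrite -Gm -!sum_nat_const -big_split /=.
  by apply: leq_sum => g /Gr; apply: leq_conflicts.
have H2 := bonferroni G conflicts.
have H3 : \sum_(g in G) \sum_(f in G | f != g) #|conflicts g :&: conflicts f|
    <= m * (m.-1 * conflict_err).
  rewrite -Gm -sum_nat_const; apply: leq_sum => g gG.
  have -> : #|G|.-1 = #|G :\ g| by rewrite (cardsD1 g G) gG.
  rewrite -sum_nat_const; rewrite [X in _ <= X](eq_bigl (fun f => (f \in G) && (f != g))); last first.
    by move=> f; rewrite !inE andbC.
  apply: leq_sum => f /andP[fG fg]; apply: conflictsI_leq; first exact: Gr.
    exact: Gr.
  by apply: Gl; rewrite // eq_sym.
have : m ^ 2 * conflict_err = m * (m.-1 * conflict_err) + m * conflict_err.
  by case: (m) => // k; rewrite -pred_Sn !expnS expn0; lia.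
lia.
Qed.

(** A conflict of [e] that is not free for [S] also conflicts with some [s] in [S]; since [e] and
    [s] share at most one vertex, [conflictsI_leq] applies. The extra unit in [#|S|.+1] pays for
    [leq_conflicts]. *)
Lemma conflicts_free_geq e S : {subset S <= rsets} -> e \in free S ->
  conflict_num <= #|conflicts e :&: free S| + #|S|.+1 * conflict_err.
Proof.
move=> Sr /freeP[er eS].
have H1 := leq_conflicts er.
have H2 : #|conflicts e :\: free S| <= #|S| * conflict_err.
  apply: leq_trans (_ : #|\bigcup_(s in S) (conflicts e :&: conflicts s)| <= _).
    apply: subset_leq_card; apply/subsetP => f; rewrite inE => /andP[fF fe].
    have fr : f \in rsets by move: fe; rewrite inE => /andP[].
    move: fF; rewrite inE fr /= => /forall_inPn[s sS]; rewrite -ltnNge => c.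
    by apply/bigcupP; exists s => //; rewrite inE fe inE fr c.
  apply: leq_trans (card_bigcup_leq _ _) _; rewrite -sum_nat_const.
  apply: leq_sum => s sS; apply: conflictsI_leq => //; last exact: eS.
  by apply/eqP; move: (Sr _ sS); rewrite inE.
have := cardsID (free S) (conflicts e); lia.
Qed.

(** * Adding and removing one edge *)

Hypothesis r_gt1 : 1 < r.

Lemma free_notin G e : e \in free G -> e \notin G.
Proof.
case/freeP=> er eG; apply/negP => /eG; rewrite setIid er; lia.
Qed.

Lemma LrU1 m G e : e \notin G ->
  (e |: G \in Lr n r m.+1) = (G \in Lr n r m) && (e \in free G).
Proof.
move=> eG; apply/LrP/andP.
- case=> Hr Hl Hm; split.
    apply/LrP; split.
    + by move=> f fG; apply: Hr; rewrite setU1r.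
    + by move=> f g fG gG; apply: Hl; rewrite setU1r.
    + by move: Hm; rewrite cardsU1 eG => -[].
  apply/freeP; split; first by apply: Hr; rewrite setU11.
  move=> f fG; apply: Hl; rewrite ?setU11 ?setU1r //.
  by apply: contraNneq eG => ->.
- case=> /LrP[Hr Hl Hm] /freeP[er eF]; split.
  + by move=> f /setU1P[->|/Hr].
  + move=> f g /setU1P[->|fG] /setU1P[->|gG] fg.
    * by rewrite eqxx in fg.
    * exact: eF.
    * by rewrite setIC; apply: eF.
    * exact: Hl.
  + by rewrite cardsU1 eG Hm.
Qed.

Lemma card_extU1 S m e : e \notin S ->
  #|ext (e |: S) m.+1| = #|[set G in ext S m | e \in free G]|.
Proof.
move=> eS.
have inj : {in [set G in ext S m | e \in free G] &, injective (fun G => e |: G)}.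
  move=> G1 G2; rewrite !inE => /andP[_ /andP[e1 f1]] /andP[_ /andP[e2 f2]] E.
  have /free_notin n1 : e \in free G1 by rewrite !inE e1.
  have /free_notin n2 : e \in free G2 by rewrite !inE e2.
  by rewrite -(setU1K n1) E setU1K.
rewrite -(card_in_imset inj); apply: eq_card => H.
apply/idP/imsetP.
- rewrite inE subUset sub1set => /and3P[HL eH SH].
  exists (H :\ e); last by rewrite setD1K.
  have : e |: (H :\ e) \in Lr n r m.+1 by rewrite setD1K.
  rewrite LrU1 ?setD11 // => /andP[HL' eF].
  by rewrite inE eF andbT inE HL' subsetD1 SH eS.
- case=> G; rewrite inE => /andP[]; rewrite inE => /andP[GL SG] eF ->.
  by rewrite inE LrU1 ?free_notin // GL eF setUS.
Qed.

Lemma sum_ext_U1 S m :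
  \sum_(e | e \notin S) #|ext (e |: S) m| = #|ext S m| * (m - #|S|).
Proof.
transitivity (\sum_(H in ext S m) \sum_(e | e \notin S) (e \in H)).
  rewrite exchange_big /=; apply: eq_bigr => e eS.
  rewrite -sum1_card big_mkcond [RHS]big_mkcond /=.
  apply: eq_bigr => H _; rewrite !inE subUset sub1set.
  by case: (e \in H); rewrite ?andbF /= ?andbT; case: ifP.
rewrite -sum_nat_const; apply: eq_bigr => H; rewrite inE => /andP[/LrP[_ _ Hm] SH].
have -> : m - #|S| = #|~: S :&: H|.
  by rewrite setIC -setDE cardsD (setIidPr SH) Hm.
by rewrite card_sum_in; apply: eq_bigl => e; rewrite inE.
Qed.

(** Both sides count the pairs of a graph [H] with [m.+1] edges containing [S] and an edge [e] of
    [H] outside [S]; on the left they are grouped by [G], the graph [H] without [e]. *)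
Lemma sum_free S m : 
  \sum_(G in ext S m) #|free G| = #|ext S m.+1| * (m.+1 - #|S|).
Proof.
rewrite -sum_ext_U1.
under [RHS]eq_bigr => e eS.
  rewrite card_extU1 //.
  rewrite (_ : [set G in _ | _] = ext S m :&: [set G | e \in free G]); last first.
    by apply/setP => G; rewrite !inE.
  rewrite card_sum_in; over.
rewrite exchange_big /=; apply: eq_bigr => G; rewrite inE => /andP[_ SG].
rewrite -[free G]setTI card_sum_in [LHS]big_mkcond [RHS]big_mkcond /=.
apply: eq_bigr => e _; rewrite in_setT.
case: (boolP (e \in S)) => /= eS; last by rewrite [in RHS]in_set.
by apply/eqP; rewrite eqb0; apply/negP => /free_notin; rewrite (subsetP SG).
Qed.

Lemma ext_leq S m f : f \notin S -> #|ext (f |: S) m.+1| <= #|ext S m|.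
Proof.
move=> fS; rewrite card_extU1 //; apply: subset_leq_card.
by apply/subsetP => G; rewrite inE => /andP[].
Qed.

Lemma ext_blocked e S m : e \notin S ->
  #|ext (e |: S) m.+1| + blocked e S m = #|ext S m|.
Proof.
move=> eS; rewrite card_extU1 // /blocked.
rewrite -(cardsID [set G | e \in free G] (ext S m)); congr (_ + _);
  by apply: eq_card => G; rewrite !inE // andbC.
Qed.

End Counting.

(** * Passage to the reals and a logarithm estimate *)

Open Scope R_scope.

Lemma INR_leq (a b : nat) : (a <= b)%N -> INR a <= INR b.
Proof. by move/leP; apply: le_INR. Qed.

Lemma INR_addn (a b : nat) : INR (a + b)%N = INR a + INR b.
Proof. exact: plus_INR. Qed.

Lemma INR_muln (a b : nat) : INR (a * b)%N = INR a * INR b.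
Proof. exact: mult_INR. Qed.

Lemma INR_subn (a b : nat) : (b <= a)%N -> INR (a - b)%N = INR a - INR b.
Proof. by move/leP; apply: minus_INR. Qed.

Lemma INR_expn (a b : nat) : INR (a ^ b)%N = INR a ^ b.
Proof. by elim: b => [|b IH] //; rewrite expnS INR_muln IH. Qed.

Lemma INR_sum_leq (I : finType) (P : {pred I}) (F : I -> nat) (B : R) :
  (forall i, i \in P -> INR (F i) <= B) ->
  INR (\sum_(i in P) F i)%N <= INR #|P| * B.
Proof.
move=> H; rewrite -sum1_card.
elim/big_rec2: _ => [|i a b Pi IH]; first by rewrite /=; lra.
rewrite !INR_addn; have := H _ Pi; rewrite /= => ?; lra.
Qed.

Lemma INR_sum_geq (I : finType) (P : {pred I}) (F : I -> nat) (B : R) :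
  (forall i, i \in P -> B <= INR (F i)) ->
  INR #|P| * B <= INR (\sum_(i in P) F i)%N.
Proof.
move=> H; rewrite -sum1_card.
elim/big_rec2: _ => [|i b a Pi IH]; first by rewrite /=; lra.
rewrite !INR_addn; have := H _ Pi; rewrite /= => ?; lra.
Qed.

Lemma ln_le x y : 0 < x -> x <= y -> ln x <= ln y.
Proof.
by move=> x0 [xy|->]; [apply: Rlt_le; apply: ln_increasing | apply: Rle_refl].
Qed.

Lemma ln_1m_bounds t : 0 <= t <= 1 / 2 -> - t - 2 * t ^ 2 <= ln (1 - t) <= - t.
Proof.
case=> t0 t1; split.
- have e1 := exp_ineq1_le (t + 2 * t ^ 2).
  have e2 : exp (- t - 2 * t ^ 2) <= 1 - t.
    have -> : - t - 2 * t ^ 2 = - (t + 2 * t ^ 2) by ring.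
    rewrite exp_Ropp; apply: (Rmult_le_reg_l (exp (t + 2 * t ^ 2))); first exact: exp_pos.
    rewrite Rinv_r; last by have := exp_pos (t + 2 * t ^ 2); lra.
    apply: Rle_trans (_ : (1 + (t + 2 * t ^ 2)) * (1 - t) <= _); last first.
      by apply: Rmult_le_compat_r; lra.
    have : 0 <= t ^ 2 * (1 - 2 * t) by apply: Rmult_le_pos; [exact: pow2_ge_0 | lra].
    lra.
  (* The lower bound rests on [(1 + t + 2 t^2) (1 - t) = 1 + t^2 (1 - 2 t)], at least 1 for
     [t <= 1 / 2]. *)
  rewrite -[X in X <= _]ln_exp.
  by apply: ln_le => //; apply: exp_pos.
- rewrite -[X in _ <= X]ln_exp; apply: ln_le; first lra.
  by have := exp_ineq1_le (- t); lra.
Qed.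

(** * The conditional probability of one further edge *)

Section Ratios.
Variables n r m : nat.
Hypothesis r_gt1 : (1 < r)%N.
Implicit Types (e f g : {set 'I_n}) (G H S : {set {set 'I_n}}).

Let N := INR 'C(n, r).
Let d := INR (conflict_num n r).
Let q := INR (conflict_err n r).
(** By [free_geq], this bounds the proportion of r-sets in conflict with a linear graph of at most
    [m] edges; it is the small parameter of the section. *)
Let a := INR m * (d / N).
Let L S j := INR #|ext r S j|.
Hypothesis N_gt0 : 0 < N.
Hypothesis a_small : a <= 1 / 100.

Lemma ext_ge0 S j : 0 <= L S j. Proof. exact: pos_INR. Qed.

Lemma conflict_ratio_ge0 : 0 <= d / N.
Proof.
apply: Rmult_le_pos; first exact: pos_INR.
by apply: Rlt_le; apply: Rinv_0_lt_compat.
Qed.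

Lemma conflict_total_ge0 : 0 <= a.
Proof. by apply: Rmult_le_pos; [exact: pos_INR | exact: conflict_ratio_ge0]. Qed.

Lemma conflict_num_ratio : d = d / N * N.
Proof. field; lra. Qed.

Lemma ext_step_geq S j : (N - INR j * d) * L S j <= L S j.+1 * INR (j.+1 - #|S|).
Proof.
rewrite /L -INR_muln -(sum_free r_gt1 S j) Rmult_comm.
apply: INR_sum_geq => G; rewrite inE => /andP[GL _].
have := INR_leq (free_geq GL); rewrite INR_addn INR_muln -/N -/d; lra.
Qed.

Lemma ext_step_leq S j :
  L S j.+1 * INR (j.+1 - #|S|) <= (N - INR j * d + INR j ^ 2 * q) * L S j.
Proof.
rewrite /L -INR_muln -(sum_free r_gt1 S j) Rmult_comm.
apply: INR_sum_leq => G; rewrite inE => /andP[GL _].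
have := INR_leq (free_leq GL); 
rewrite !INR_addn (INR_muln (j ^ 2)) INR_expn INR_muln -/N -/d -/q; lra.
Qed.

Lemma ext_step_leq_total S j : L S j.+1 * INR (j.+1 - #|S|) <= N * L S j.
Proof.
rewrite /L -INR_muln -(sum_free r_gt1 S j) Rmult_comm.
apply: INR_sum_leq => G _; apply: INR_leq; rewrite -card_rsets.
by apply: subset_leq_card; apply/subsetP => e; rewrite inE => /andP[].
Qed.

Lemma conflict_partial j : (j <= m)%N -> INR j * d <= a * N.
Proof.
move=> jm; rewrite {1}conflict_num_ratio /a; have := conflict_ratio_ge0.
have := INR_leq jm => H1 H2; rewrite -Rmult_assoc.
apply: Rmult_le_compat_r; first lra.
exact: Rmult_le_compat_r.
Qed.

(** Greedy extension: as [a < 1], a graph with fewer than [m] edges always has a free r-set. This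
    makes the later divisions legitimate. *)
Lemma ext_gt0 S j : S \in Lr n r #|S| -> (#|S| <= j)%N -> (j <= m)%N -> 0 < L S j.
Proof.
move=> SL; elim: j => [|j IH] Sj jm.
  move: Sj; rewrite leqn0 => /eqP S0.
  by rewrite /L -S0 ext_id //; apply: Rlt_0_1.
have [SE|Sj'] := ltnP j #|S|.
  have -> : j.+1 = #|S| by apply/eqP; rewrite eqn_leq SE Sj.
  by rewrite /L ext_id //; apply: Rlt_0_1.
have H0 := IH Sj' (ltnW jm).
have H1 := ext_step_geq S j.
have H2 := conflict_partial (ltnW jm).
have H3 : 0 < (N - INR j * d) * L S j by apply: Rmult_lt_0_compat; nra.
have H4 := pos_INR (j.+1 - #|S|); have := ext_ge0 S j.+1; nra.
Qed.

(** Forgetting [f] leaves a graph with one edge fewer, and [ext_step_geq] compares the two edge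
    counts up to a factor [1 / (1 - a)], at most [1 + 2 a]. *)
Lemma extU1_leq S j f : f \notin S -> (j <= m)%N ->
  L (f |: S) j <= INR (j - #|S|) / N * (1 + 2 * a) * L S j.
Proof.
have a0 := conflict_total_ge0.
move=> fS jm; have M0 := pos_INR (j - #|S|); have L0 := ext_ge0 S j.
have NV : 0 < / N by apply: Rinv_0_lt_compat.
case: j jm M0 L0 => [|j] jm M0 L0.
  rewrite {1}/L ext_small /=; last by rewrite cardsU1 fS.
  apply: Rmult_le_pos => //; apply: Rmult_le_pos; last lra.
  by apply: Rmult_le_pos => //; lra.
have H1 : L (f |: S) j.+1 <= L S j by apply: INR_leq; apply: ext_leq.
apply: Rle_trans H1 _.
have H1 := ext_step_geq S j.
have H2 := conflict_partial (ltnW jm).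
have H3 := ext_ge0 S j.
set M := INR _ in M0 H1 *; set L1 := L S j.+1 in L0 H1 *; set L' := L S j in H3 H1 *.
have H4 : (1 - a) * N * L' <= L1 * M.
  by apply: Rle_trans H1; apply: Rmult_le_compat_r => //; lra.
have H5 : (1 - a) * L' <= L1 * M / N.
  apply: (Rmult_le_reg_r N) => //.
  have -> : L1 * M / N * N = L1 * M by field; lra.
  lra.
have H6 : L' <= (1 + 2 * a) * ((1 - a) * L').
  have : 0 <= a * (1 - 2 * a) * L'.
    by apply: Rmult_le_pos => //; apply: Rmult_le_pos; lra.
  lra.
apply: Rle_trans H6 _.
have -> : M / N * (1 + 2 * a) * L1 = (1 + 2 * a) * (L1 * M / N) by rewrite /Rdiv; ring.
by apply: Rmult_le_compat_l; lra.
Qed.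

Lemma extU2_leq S j f g : f \notin S -> g \notin S -> g != f -> (j <= m)%N ->
  L (g |: (f |: S)) j <= (INR (j - #|S|) / N * (1 + 2 * a)) ^ 2 * L S j.
Proof.
move=> fS gS gf jm.
have a0 := conflict_total_ge0.
have NV : 0 < / N by apply: Rinv_0_lt_compat.
have gfS : g \notin f |: S by rewrite !inE negb_or gf.
have H1 := extU1_leq gfS jm; have H2 := extU1_leq fS jm.
have M1 : INR (j - #|f |: S|) <= INR (j - #|S|).
  by apply: INR_leq; apply: leq_sub2l; apply: subset_leq_card; apply: subsetUr.
have M0 := pos_INR (j - #|f |: S|).
set M' := INR _ in H1 M1 M0; set M := INR _ in H2 M1 *.
have k0 : 0 <= M' / N * (1 + 2 * a).
  by apply: Rmult_le_pos; [apply: Rmult_le_pos | ]; lra.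
have k1 : M' / N * (1 + 2 * a) <= M / N * (1 + 2 * a).
  by apply: Rmult_le_compat_r; [lra | apply: Rmult_le_compat_r; lra].
apply: Rle_trans H1 _.
have -> : (M / N * (1 + 2 * a)) ^ 2 * L S j =
  M / N * (1 + 2 * a) * (M / N * (1 + 2 * a) * L S j) by ring.
have := ext_ge0 (f |: S) j => L0.
exact: Rmult_le_compat.
Qed.

Lemma blocked_upper S j e : e \in free r S -> (j <= m)%N ->
  INR (blocked r e S j) <= d / N * INR (j - #|S|) * (1 + 2 * a) * L S j.
Proof.
move=> eS jm; have a0 := conflict_total_ge0.
have /freeP[er eS'] := eS.
have NV : 0 < / N by apply: Rinv_0_lt_compat.
apply: Rle_trans (INR_leq (blocked_leq j eS)) _.
apply: Rle_trans (INR_sum_leq (B := INR (j - #|S|) / N * (1 + 2 * a) * L S j) _) _.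
  move=> f; rewrite inE => /andP[_ fS]; apply: extU1_leq => //; exact: free_notin fS.
have -> : d / N * INR (j - #|S|) * (1 + 2 * a) * L S j =
  d * (INR (j - #|S|) / N * (1 + 2 * a) * L S j) by rewrite /Rdiv; ring.
apply: Rmult_le_compat_r.
  have := pos_INR (j - #|S|); have := ext_ge0 S j => ? ?.
  by apply: Rmult_le_pos => //; apply: Rmult_le_pos; [apply: Rmult_le_pos|]; lra.
apply: INR_leq; apply: leq_trans (conflicts_leq er).
by apply: subset_leq_card; apply: subsetIl.
Qed.

Lemma conflict_partial_ratio j : (j <= m)%N -> d / N * INR j <= a.
Proof.
by move=> jm; rewrite /a Rmult_comm; apply: Rmult_le_compat_r;
  [exact: conflict_ratio_ge0 | exact: INR_leq].
Qed.

(** The converse crude bound: at most a proportion [2 a] of the smaller graphs is blocked for [f],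
    and each has at most [N] free r-sets. *)
Lemma leq_extU1 S j f : f \in free r S -> (j <= m)%N ->
  INR (j - #|S|) / N * (1 - 2 * a) * L S j <= L (f |: S) j.
Proof.
move=> fS jm; have a0 := conflict_total_ge0.
case: j jm => [|j] jm.
  by rewrite sub0n /Rdiv !Rmult_0_l; apply: ext_ge0.
have fS' := free_notin r_gt1 fS.
have H1 : L (f |: S) j.+1 + INR (blocked r f S j) = L S j.
  by rewrite -INR_addn ext_blocked.
have H2 := blocked_upper fS (ltnW jm).
have H3 := ext_step_leq_total S j.
have H4 : d / N * INR (j - #|S|) <= a.
  by apply: conflict_partial_ratio; lia.
have H5 : 0 <= d / N * INR (j - #|S|).
  by apply: Rmult_le_pos; [exact: conflict_ratio_ge0 | exact: pos_INR].
have L0 := ext_ge0 S j.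
have H6 : d / N * INR (j - #|S|) * (1 + 2 * a) * L S j <= 2 * a * L S j.
  by apply: Rmult_le_compat_r => //; nra.
have H7 : (1 - 2 * a) * L S j <= L (f |: S) j.+1 by lra.
apply: Rle_trans H7.
have -> : INR (j.+1 - #|S|) / N * (1 - 2 * a) * L S j.+1 =
  (1 - 2 * a) * (L S j.+1 * INR (j.+1 - #|S|) / N) by rewrite /Rdiv; ring.
apply: Rmult_le_compat_l; first lra.
apply: (Rmult_le_reg_r N) => //.
have -> : L S j.+1 * INR (j.+1 - #|S|) / N * N = L S j.+1 * INR (j.+1 - #|S|).
  by field; lra.
lra.
Qed.

(** Second-order Bonferroni. Conflicts of [e] lost to [S] cost [m^2 q / N]; the factor [1 - 2 a] of
    [leq_extU1] costs [2 a^2]; the pairs [f], [g] cost another [2 a^2], since [(1 + 2 a)^2 <= 2]. *)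
Lemma blocked_lower S j e : {subset S <= rsets n r} -> e \in free r S ->
  (#|S| < m)%N -> (j <= m)%N ->
  (d / N * INR (j - #|S|) - INR m ^ 2 * (q / N) - 4 * a ^ 2) * L S j <=
  INR (blocked r e S j).
Proof.
move=> Sr eS Sm jm; have a0 := conflict_total_ge0.
have /freeP[er eS'] := eS.
have NV : 0 < / N by apply: Rinv_0_lt_compat.
have y0 := conflict_ratio_ge0.
have L0 := ext_ge0 S j.
have z0 : 0 <= q / N by apply: Rmult_le_pos; [exact: pos_INR | lra].
have M0 := pos_INR (j - #|S|).
have Mm : INR (j - #|S|) <= INR m by apply: INR_leq; lia.
have Mj : d / N * INR (j - #|S|) <= a.
  by apply: conflict_partial_ratio; lia.
have H1 := INR_leq (leq_blocked j eS); rewrite INR_addn in H1.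
have H2 := INR_leq (conflicts_free_geq Sr eS).
rewrite INR_addn INR_muln -/d -/q in H2.
have Sm' : INR #|S|.+1 <= INR m by apply: INR_leq.
have S0 := pos_INR #|S|.+1.
have ub : INR #|conflicts r e :&: free r S| <= d.
  apply: INR_leq; apply: leq_trans (conflicts_leq er).
  by apply: subset_leq_card; apply: subsetIl.
set F := conflicts r e :&: free r S in H1 H2 ub.
set M := INR (j - #|S|) in M0 Mm Mj *.
have FS f : f \in F -> f \notin S.
  by rewrite inE => /andP[_ fS]; apply: free_notin fS.
have H3 : INR #|F| * (M / N * (1 - 2 * a) * L S j) <=
    INR (\sum_(f in F) #|ext r (f |: S) j|)%N.
  by apply: INR_sum_geq => f; rewrite inE => /andP[_ fS]; apply: leq_extU1.
have c0 := pos_INR #|F|.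
have H4 : INR (\sum_(f in F) \sum_(g in F | g != f) #|ext r (g |: (f |: S)) j|)%N
   <= d * (d * ((M / N * (1 + 2 * a)) ^ 2 * L S j)).
  have p0 : 0 <= (M / N * (1 + 2 * a)) ^ 2 * L S j.
    by apply: Rmult_le_pos => //; apply: pow2_ge_0.
  have d0 : 0 <= d by apply: pos_INR.
  apply: Rle_trans (INR_sum_leq (B := d * ((M / N * (1 + 2 * a)) ^ 2 * L S j)) _) _;
    last by apply: Rmult_le_compat_r => //; apply: Rmult_le_pos.
  move=> f fF.
  apply: Rle_trans (INR_sum_leq (P := [pred g in F | g != f])
    (B := (M / N * (1 + 2 * a)) ^ 2 * L S j) _) _.
    by move=> g /andP[gF gf]; apply: extU2_leq => //; apply: FS.
  apply: Rmult_le_compat_r => //; apply: Rle_trans ub.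
  by apply: INR_leq; apply: subset_leq_card; apply/subsetP => g /andP[].
have H5 : d * (d * ((M / N * (1 + 2 * a)) ^ 2 * L S j)) =
   (d / N * M * (1 + 2 * a)) ^ 2 * L S j by field; lra.
have yM0 : 0 <= d / N * M by apply: Rmult_le_pos.
have H6 : (d / N * M * (1 + 2 * a)) ^ 2 <= 2 * a ^ 2 by nra.
have H7 : (d / N * M * (1 + 2 * a)) ^ 2 * L S j <= 2 * a ^ 2 * L S j.
  exact: Rmult_le_compat_r.
have H8 : (d / N * M - INR m ^ 2 * (q / N) - 2 * a ^ 2) * L S j <=
  INR #|F| * (M / N * (1 - 2 * a) * L S j).
  have -> : INR #|F| * (M / N * (1 - 2 * a) * L S j) =
     (INR #|F| / N * M * (1 - 2 * a)) * L S j by rewrite /Rdiv; ring.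
  apply: Rmult_le_compat_r => //.
  have B1 : d - INR m * q <= INR #|F|.
    have : INR #|S|.+1 * q <= INR m * q by apply: Rmult_le_compat_r => //; exact: pos_INR.
    lra.
  have B2 : d / N - INR m * (q / N) <= INR #|F| / N.
    have -> : d / N - INR m * (q / N) = (d - INR m * q) * / N by rewrite /Rdiv; ring.
    by apply: Rmult_le_compat_r; lra.
  have B3 : (d / N - INR m * (q / N)) * (M * (1 - 2 * a)) <= INR #|F| / N * (M * (1 - 2 * a)).
    by apply: Rmult_le_compat_r => //; apply: Rmult_le_pos; lra.
  have B4 : INR m * (q / N) * (M * (1 - 2 * a)) <= INR m * (q / N) * INR m.
    apply: Rmult_le_compat_l; last by nra.
    by apply: Rmult_le_pos => //; apply: pos_INR.
  have B5 : d / N * M * (2 * a) <= a * (2 * a) by apply: Rmult_le_compat_r; lra.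
  have : (d / N) * (M * (1 - 2 * a)) = d / N * M - d / N * M * (2 * a) by ring.
  nra.
lra.
Qed.

(** The fine bound on [rho] gives the first term of the final minimum; the crude bound [5 a] gives
    the second. *)
Lemma ext_ratio S e : S \in Lr n r #|S| -> e \in free r S -> (#|S| < m)%N ->
  exists rho, [/\ L (e |: S) m = INR (m - #|S|) / N * exp rho * L S m,
    Rabs (rho - d / N * INR #|S|) <= 30 * a ^ 2 + 2 * (INR m ^ 2 * (q / N)) &
    Rabs rho <= 5 * a].
Proof.
move=> SL eS Sm.
have [j jE] : exists j, m = j.+1 by case: (m) Sm => // j _; exists j.
have jm : (j <= m)%N by rewrite jE.
have Sj : (#|S| <= j)%N by rewrite -ltnS -jE.
have a0 := conflict_total_ge0.
have y0 := conflict_ratio_ge0.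
have NV : 0 < / N by apply: Rinv_0_lt_compat.
have z0 : 0 <= q / N by apply: Rmult_le_pos; [exact: pos_INR | lra].
have Sr : {subset S <= rsets n r}.
  by case/LrP: SL => Sr _ _ f fS; rewrite inE Sr.
have P0 := ext_gt0 SL Sj jm.
have Q0 := ext_gt0 SL (ltnW Sm) (leqnn m).
have HB : L (e |: S) m + INR (blocked r e S j) = L S j.
  by rewrite /L jE -INR_addn ext_blocked // (free_notin r_gt1).
have HB1 := blocked_upper eS jm.
have HB2 := blocked_lower Sr eS Sm jm.
have HX1 := ext_step_geq S j; have HX2 := ext_step_leq S j.
have HX3 := ext_step_leq_total S j.
rewrite -jE in HX1 HX2 HX3.
rewrite (INR_subn Sj) in HB1 HB2.
have ms0 : 0 < INR (m - #|S|) by rewrite INR_subn; [have /ltP/lt_INR := Sm; lra | exact: ltnW].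
have Ba := conflict_partial_ratio jm.
have jm' := INR_leq jm; have j0 := pos_INR j; have s0 := pos_INR #|S|.
have sj := INR_leq Sj.
have B0 := pos_INR (blocked r e S j).
set B := INR (blocked _ _ _ _) in HB HB1 HB2 B0.
set P := L S j in HB HB1 HB2 HX1 HX2 HX3 P0.
set W := INR (m - #|S|) in HX1 HX2 HX3 ms0 *.
set Q := L S m in HX1 HX2 HX3 Q0 *.
set y := d / N in y0 HB1 HB2 Ba *.
set z := q / N in z0 HB2 *.
set s := INR #|S| in HB1 HB2 s0 sj *.
set k := INR j in HB1 HB2 Ba HX1 HX2 j0 jm' sj *.
have dE : d = y * N by rewrite /y; field; lra.
have qE : q = z * N by rewrite /z; field; lra.
have NP : 0 < N * P by apply: Rmult_lt_0_compat.
have cB : B = B / P * P by field; lra.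
have XB : Q * W = Q * W / (N * P) * (N * P) by field; lra.
have QW0 : 0 < Q * W by apply: Rmult_lt_0_compat.
have X0 : 0 < Q * W / (N * P) by apply: Rdiv_lt_0_compat.
have c0 : 0 <= B / P by apply: Rmult_le_pos => //; apply: Rlt_le; apply: Rinv_0_lt_compat.
set c := B / P in cB c0.
set X := Q * W / (N * P) in XB X0.
have c1 : c <= y * (k - s) * (1 + 2 * a).
  by apply: (Rmult_le_reg_r P) => //; rewrite -cB.
have c2 : y * (k - s) - INR m ^ 2 * z - 4 * a ^ 2 <= c.
  by apply: (Rmult_le_reg_r P) => //; rewrite -cB.
have X1 : 1 - k * y <= X.
  apply: (Rmult_le_reg_r (N * P)) => //; rewrite -XB.
  by apply: Rle_trans HX1; rewrite dE; apply: Req_le; ring.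
have X2 : X <= 1 - k * y + INR m ^ 2 * z.
  apply: Rle_trans (_ : 1 - k * y + k ^ 2 * z <= _).
    apply: (Rmult_le_reg_r (N * P)) => //; rewrite -XB.
    by apply: Rle_trans HX2 _; rewrite dE qE; apply: Req_le; ring.
  apply: Rplus_le_compat_l; apply: Rmult_le_compat_r => //.
  by apply: pow_incr.
have X3 : X <= 1.
  by apply: (Rmult_le_reg_r (N * P)) => //; rewrite -XB; lra.
have yM0 : 0 <= y * (k - s) by apply: Rmult_le_pos; lra.
have yMa : y * (k - s) <= a.
  apply: Rle_trans Ba; apply: Rmult_le_compat_l; lra.
have c3 : c <= y * (k - s) + 2 * a ^ 2.
  have : y * (k - s) * a <= a * a by apply: Rmult_le_compat_r.
  lra.
have ca : c <= 2 * a by nra.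
have [l1 l2] : - c - 2 * c ^ 2 <= ln (1 - c) <= - c by apply: ln_1m_bounds; lra.
have [l3 l4] : - (1 - X) - 2 * (1 - X) ^ 2 <= ln (1 - (1 - X)) <= - (1 - X).
  by apply: ln_1m_bounds; lra.
have l5 : 1 - (1 - X) = X by ring.
rewrite l5 in l3 l4.
have c4 : c ^ 2 <= (2 * a) ^ 2 by apply: pow_incr; lra.
have X4 : (1 - X) ^ 2 <= a ^ 2 by apply: pow_incr; lra.
have a2 : a ^ 2 <= a / 100.
  by rewrite /= Rmult_1_r /Rdiv; apply: Rmult_le_compat_l => //; lra.
have z2 : 0 <= INR m ^ 2 * z by apply: Rmult_le_pos => //; apply: pow2_ge_0.
have a3 := pow2_ge_0 a.
(* Here [c] is the blocked proportion, close to [y (k - s)], and [X] is the average proportion of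
   free r-sets, close to [1 - k y], with [k = m - 1]. The terms in [k] cancel and leave [y s]; the
   stated constants leave room to spare. *)
exists (ln (1 - c) - ln X); split.
- have -> : L (e |: S) m = P * (1 - c) by lra.
  rewrite /Rminus exp_plus exp_Ropp !exp_ln; try lra.
  by rewrite /X; field; lra.
- by apply: Rabs_le; split; nra.
- by apply: Rabs_le; split; nra.
Qed.

End Ratios.

(** * Multiplication over the edges *)

Lemma ext_product (n r m : nat) (S : {set {set 'I_n}}) (Y E : R) :
  0 < INR 'C(n, r) ->
  (forall (T : {set {set 'I_n}}) e, T \in Lr n r #|T| -> e \in free r T ->
     (#|T| < m)%N ->
     exists2 rho, Rabs (rho - Y * INR #|T|) <= E &
       INR #|ext r (e |: T) m| =
         INR (m - #|T|) / INR 'C(n, r) * exp rho * INR #|ext r T m|) ->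
  S \in Lr n r #|S| -> (#|S| <= m)%N ->
  exists2 delta, Rabs delta <= INR #|S| * E &
    INR #|ext r S m| = INR (m ^_ #|S|) / INR 'C(n, r) ^ #|S| *
      exp (Y * (INR #|S| * (INR #|S| - 1) / 2) + delta) *
      INR #|ext r (set0 : {set {set 'I_n}}) m|.
Proof.
move=> N0 step; move sE: #|S| => s; elim: s S sE => [|s IH] S sE SL Sm.
  exists 0; first by rewrite Rabs_R0 /=; lra.
  rewrite (cards0_eq sE) ffactn0 /= Rmult_0_l /Rdiv Rmult_0_l Rmult_0_r Rplus_0_r.
  by rewrite exp_0 Rinv_1 !Rmult_1_l.
have /card_gt0P[e eS] : (0 < #|S|)%N by rewrite sE.
have sE' : #|S :\ e| = s by move: sE; rewrite (cardsD1 e) eS => -[].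
have : e |: (S :\ e) \in Lr n r s.+1 by rewrite setD1K.
rewrite LrU1 ?setD11 // => /andP[TL eT].
have [delta dl EQ] := IH _ sE' TL (ltnW Sm).
have TL' : S :\ e \in Lr n r #|S :\ e| by rewrite sE'.
have [rho rl EQ'] := step _ _ TL' eT ltac:(by rewrite sE').
(* The main exponents [Y * i] for [i < s.+1] add up to [Y] times a triangular number, so only the
   deviation of [rho] from [Y * s] enters the error. *)
exists (delta + (rho - Y * INR s)).
  apply: Rle_trans (Rabs_triang _ _) _; rewrite S_INR.
  by rewrite sE' in rl; lra.
rewrite -[in LHS](setD1K eS) EQ' EQ sE' ffactnSr INR_muln S_INR /=.
have -> : Y * ((INR s + 1) * (INR s + 1 - 1) / 2) + (delta + (rho - Y * INR s)) =
  rho + (Y * (INR s * (INR s - 1) / 2) + delta) by field.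
rewrite (exp_plus rho); field; split; last lra.
by apply: pow_nonzero; lra.
Qed.

(** * Sizes of the conflict parameters in terms of n, r and m *)

Lemma ffact_expn_leq (n r t : nat) : (r <= n)%N -> (r ^_ t * n ^ t <= r ^ t * n ^_ t)%N.
Proof.
move=> rn; elim: t => // t IH; rewrite !ffactnSr !expnSr.
have H : ((r - t) * n <= r * (n - t))%N by rewrite mulnBl mulnBr leq_sub2l // mulnC leq_mul2l rn orbT.
by rewrite mulnACA [X in (_ <= X)%N]mulnACA leq_mul.
Qed.

Lemma superset_num_leq (n r t : nat) : (r <= n)%N -> (t <= n)%N ->
  (superset_num n r t * n ^ t <= 'C(n, r) * r ^ t)%N.
Proof.
move=> rn tn; have nt : (0 < n ^_ t)%N by rewrite ffact_gt0.
rewrite -(leq_pmul2r nt) mulnAC superset_num_ffact // -!mulnA leq_mul2l.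
by rewrite ffact_expn_leq ?orbT.
Qed.

Lemma ffact2_INR (x : nat) : INR (x ^_ 2) = INR x * (INR x - 1).
Proof.
case: x => [|x]; first by rewrite ffact0n /= Rmult_0_l.
by rewrite ffactSS ffactn1 INR_muln [INR x.+1]S_INR; ring.
Qed.

Section Estimates.
Variables n r m : nat.
Hypothesis r_ge3 : (2 < r)%N.
Hypothesis m_gt0 : (0 < m)%N.
Let ro := INR r.
Let mu := INR m.
Let nu := INR n.
Hypothesis dense : mu ^ 2 * ro ^ 6 <= nu ^ 3 / 1000000.

Let ro_ge3 : 3 <= ro.
Proof. by have := INR_leq r_ge3; rewrite /ro /=; lra. Qed.

Let mu_ge1 : 1 <= mu.
Proof. by have := INR_leq m_gt0. Qed.

(** As [m >= 1], the hypothesis [dense] bounds [ro ^ 6] by [(nu / 100) ^ 3]; then take cube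
    roots. *)
Lemma uniformity_sqr_leq : ro ^ 2 <= nu / 100.
Proof.
have nu0 : 0 <= nu by apply: pos_INR.
have H : (ro ^ 2) ^ 3 <= (nu / 100) ^ 3.
  have -> : (ro ^ 2) ^ 3 = 1 * ro ^ 6 by ring.
  have -> : (nu / 100) ^ 3 = nu ^ 3 / 1000000 by field.
  apply: Rle_trans dense; apply: Rmult_le_compat_r; first by apply: pow_le; lra.
  by have := pow_incr 1 mu 2; rewrite pow1; apply; lra.
case: (Rle_lt_dec (ro ^ 2) (nu / 100)) => // lt.
have r2 := pow2_ge_0 ro.
have : (nu / 100) ^ 3 < (ro ^ 2) ^ 3.
  move: (ro ^ 2) lt r2 => b lt b0; set c := nu / 100 in lt *.
  have c0 : 0 <= c by rewrite /c; lra.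
  have : 0 < (b - c) * (b ^ 2 + b * c + c ^ 2).
    apply: Rmult_lt_0_compat; first lra.
    have : 0 < b ^ 2 by apply: pow_lt; lra.
    have : 0 <= b * c by apply: Rmult_le_pos.
    have := pow2_ge_0 c; lra.
  lra.
lra.
Qed.

Lemma order_ge900 : 900 <= nu.
Proof. have := uniformity_sqr_leq; nra. Qed.

Lemma uniformity_leq_order : (r <= n)%N.
Proof.
have := uniformity_sqr_leq; have := order_ge900 => H1 H2.
have H : ro <= nu by nra.
by apply/leP/INR_le.
Qed.

Lemma bin_INR_gt0 : 0 < INR 'C(n, r).
Proof. by apply: lt_0_INR; apply/ltP; rewrite bin_gt0 uniformity_leq_order. Qed.

Let y := INR (conflict_num n r) / INR 'C(n, r).
Let z := INR (conflict_err n r) / INR 'C(n, r).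
(** The leading value of [y], with [nu * (nu - 1)] replaced by [nu ^ 2]. *)
Let Y := INR (r ^_ 2) ^ 2 / (2 * nu ^ 2).
Let E1 := ro ^ 6 * mu ^ 2 / nu ^ 3.
Let x := ro ^ 4 * mu / nu ^ 2.

Lemma conflict_ratioE : y = (ro * (ro - 1)) ^ 2 / (2 * (nu * (nu - 1))).
Proof.
have N0 := bin_INR_gt0; have n9 := order_ge900.
have n2 : (2 <= n)%N.
  by apply/leP; apply: INR_le; rewrite -/nu /=; lra.
have := superset_num_ffact r n2 => /(congr1 INR).
rewrite (INR_muln (superset_num _ _ _)) (INR_muln 'C(n, r)) !ffact2_INR -/nu -/ro => HW.
have HC : INR 'C(r, 2) * 2 = ro * (ro - 1).
  by have := bin_ffact r 2 => /(congr1 INR); rewrite INR_muln ffact2_INR.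
rewrite /y /conflict_num INR_muln.
set w := INR (superset_num _ _ _) in HW *; set N := INR _ in N0 HW *.
have wE : w = N * (ro * (ro - 1)) / (nu * (nu - 1)).
  by rewrite -HW; field; lra.
by rewrite wE -HC; field; lra.
Qed.

(** Triples contribute at most [ro ^ 6 / nu ^ 3], quadruples at most that times
    [ro ^ 2 / nu <= 1]. *)
Lemma conflict_err_ratio : z <= 2 * (ro ^ 6 / nu ^ 3).
Proof.
have N0 := bin_INR_gt0; have n9 := order_ge900; have rn := uniformity_leq_order.
have u := uniformity_sqr_leq.
have n4 : (4 <= n)%N.
  by apply/leP; apply: INR_le; rewrite -/nu /=; lra.
have nu3 : 0 < nu ^ 3 by apply: pow_lt; lra.
have nu4 : 0 < nu ^ 4 by apply: pow_lt; lra.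
have := INR_leq (superset_num_leq rn (ltnW n4)).
have := INR_leq (superset_num_leq rn n4).
rewrite /z /conflict_err INR_addn (INR_muln (r ^ 3)) (INR_muln (r ^ 4)).
rewrite !(INR_muln (superset_num _ _ _)) !(INR_muln 'C(n, r)) !INR_expn -/nu -/ro.
set N := INR _ in N0 *; set w3 := INR (superset_num n r 3); set w4 := INR (superset_num n r 4).
move=> H4 H3.
have W3 : w3 / N <= ro ^ 3 / nu ^ 3.
  apply: (Rmult_le_reg_r (N * nu ^ 3)); first exact: Rmult_lt_0_compat.
  have -> : w3 / N * (N * nu ^ 3) = w3 * nu ^ 3 by field; lra.
  by have -> : ro ^ 3 / nu ^ 3 * (N * nu ^ 3) = N * ro ^ 3 by field; lra.
have W4 : w4 / N <= ro ^ 4 / nu ^ 4.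
  apply: (Rmult_le_reg_r (N * nu ^ 4)); first exact: Rmult_lt_0_compat.
  have -> : w4 / N * (N * nu ^ 4) = w4 * nu ^ 4 by field; lra.
  by have -> : ro ^ 4 / nu ^ 4 * (N * nu ^ 4) = N * ro ^ 4 by field; lra.
have -> : (ro ^ 3 * w3 + ro ^ 4 * w4) / N = ro ^ 3 * (w3 / N) + ro ^ 4 * (w4 / N).
  by field; lra.
have r3 : 0 <= ro ^ 3 by apply: pow_le; lra.
have r4 : 0 <= ro ^ 4 by apply: pow_le; lra.
have := Rmult_le_compat_l _ _ _ r3 W3; have := Rmult_le_compat_l _ _ _ r4 W4.
have -> : ro ^ 3 * (ro ^ 3 / nu ^ 3) = ro ^ 6 / nu ^ 3 by field; lra.
have -> : ro ^ 4 * (ro ^ 4 / nu ^ 4) = ro ^ 6 / nu ^ 3 * (ro ^ 2 / nu) by field; lra.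
have e0 : 0 <= ro ^ 6 / nu ^ 3.
  by apply: Rmult_le_pos; [apply: pow_le; lra | apply: Rlt_le; exact: Rinv_0_lt_compat].
have e1 : ro ^ 2 / nu <= 1.
  apply: (Rmult_le_reg_r nu); first lra.
  by have -> : ro ^ 2 / nu * nu = ro ^ 2; [field; lra | lra].
have := Rmult_le_compat_l _ _ _ e0 e1; lra.
Qed.

Lemma conflict_ratio_leq : 0 <= y <= ro ^ 4 / nu ^ 2.
Proof.
have n9 := order_ge900; rewrite conflict_ratioE.
have D0 : 0 < / (2 * (nu * (nu - 1))) by apply: Rinv_0_lt_compat; nra.
have r0 : 0 <= ro * (ro - 1) by nra.
split; first by apply: Rmult_le_pos; [exact: pow2_ge_0 | lra].
have H1 : (ro * (ro - 1)) ^ 2 <= ro ^ 4.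
  have -> : ro ^ 4 = (ro * ro) ^ 2 by ring.
  by apply: pow_incr; split; nra.
have H2 : / (2 * (nu * (nu - 1))) <= / nu ^ 2 by apply: Rinv_le_contravar; nra.
by apply: Rmult_le_compat => //; [exact: pow2_ge_0 | lra].
Qed.

Lemma conflict_ratio_approx : Y <= y <= Y + ro ^ 6 / nu ^ 3.
Proof.
have n9 := order_ge900.
have -> : y = Y + (ro * (ro - 1)) ^ 2 * / (2 * (nu ^ 2 * (nu - 1))).
  by rewrite conflict_ratioE /Y ffact2_INR -/ro; field; lra.
have D0 : 0 < / (2 * (nu ^ 2 * (nu - 1))).
  apply: Rinv_0_lt_compat; apply: Rmult_lt_0_compat; first lra.
  by apply: Rmult_lt_0_compat; [apply: pow_lt; lra | lra].
have := pow2_ge_0 (ro * (ro - 1)) => p0.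
have := Rmult_le_pos _ _ p0 (Rlt_le _ _ D0) => p1.
split; first lra.
apply: Rplus_le_compat_l; apply: Rmult_le_compat => //; first lra.
  have -> : ro ^ 6 = (ro * ro * ro) ^ 2 by ring.
  by apply: pow_incr; split; nra.
apply: Rinv_le_contravar; first by apply: pow_lt; lra.
have : 0 <= nu ^ 2 * (nu - 2) by apply: Rmult_le_pos; [exact: pow2_ge_0 | lra].
lra.
Qed.

Lemma step_parameters : mu * y <= 1 / 100 /\
  forall rho s, 0 <= s <= mu ->
   Rabs (rho - y * s) <= 30 * (mu * y) ^ 2 + 2 * (mu ^ 2 * z) ->
   Rabs rho <= 5 * (mu * y) ->
   Rabs (rho - Y * s) <= 35 * Rmin E1 (ro ^ 5 * mu / nu ^ 2).
Proof.
have n9 := order_ge900; have u := uniformity_sqr_leq.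
have [y0 y1] := conflict_ratio_leq; have [Y0 Y1] := conflict_ratio_approx.
have z1 := conflict_err_ratio.
have nu3 : 0 < / nu ^ 3 by apply: Rinv_0_lt_compat; apply: pow_lt; lra.
have nu2 : 0 < / nu ^ 2 by apply: Rinv_0_lt_compat; apply: pow_lt; lra.
have a0 : 0 <= mu * y by apply: Rmult_le_pos; lra.
have ax : mu * y <= x.
  have -> : x = mu * (ro ^ 4 / nu ^ 2) by rewrite /x; field; lra.
  by apply: Rmult_le_compat_l; lra.
have E10 : 0 <= E1.
  by apply: Rmult_le_pos; [apply: Rmult_le_pos; apply: pow_le |]; lra.
have x0 : 0 <= x by lra.
have e1 : ro ^ 2 / nu <= 1 / 100.
  apply: (Rmult_le_reg_r nu); first lra.
  by have -> : ro ^ 2 / nu * nu = ro ^ 2; [field; lra | lra].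
(* This absorbs the quadratic error [30 (mu * y)^2], as [mu * y <= x], into the scale [E1]. *)
have xE : x ^ 2 <= E1 * (1 / 100).
  have -> : x ^ 2 = E1 * (ro ^ 2 / nu) by rewrite /x /E1; field; lra.
  exact: Rmult_le_compat_l.
have Esmall : E1 <= 1 / 1000000.
  apply: (Rmult_le_reg_r (nu ^ 3)); first by apply: pow_lt; lra.
  have -> : E1 * nu ^ 3 = mu ^ 2 * ro ^ 6 by rewrite /E1; field; lra.
  lra.
have xs : x <= 1 / 100 by nra.
split; first lra.
move=> rho s [s0 s1] H1 H2.
have a2 : (mu * y) ^ 2 <= x ^ 2 by apply: pow_incr; lra.
have mz : mu ^ 2 * z <= 2 * E1.
  have -> : 2 * E1 = mu ^ 2 * (2 * (ro ^ 6 / nu ^ 3)) by rewrite /E1; field; lra.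
  by apply: Rmult_le_compat_l; [exact: pow2_ge_0 | ].
have yY : Rabs (y * s - Y * s) <= E1.
  rewrite -Rmult_minus_distr_r Rabs_mult !Rabs_pos_eq; try lra.
  have -> : E1 = ro ^ 6 / nu ^ 3 * mu ^ 2 by rewrite /E1; field; lra.
  by apply: Rmult_le_compat; try lra; nra.
have xr : x <= ro ^ 5 * mu / nu ^ 2.
  have -> : ro ^ 5 * mu / nu ^ 2 = ro * x by rewrite /x; field; lra.
  nra.
have Yp : 0 <= Y by apply: Rmult_le_pos; [exact: pow2_ge_0 | rewrite Rinv_mult; lra].
have Ys : 0 <= Y * s <= x.
  split; first exact: Rmult_le_pos.
  apply: Rle_trans ax; rewrite Rmult_comm; apply: Rmult_le_compat; lra.
have T1 : Rabs (rho - Y * s) <= 35 * E1.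
  have -> : rho - Y * s = (rho - y * s) + (y * s - Y * s) by ring.
  by apply: Rle_trans (Rabs_triang _ _) _; lra.
(* For the other term of the minimum no cancellation is used: [rho] and [Y * s] are each of order
   [x]. *)
have T2 : Rabs (rho - Y * s) <= 35 * x.
  apply: Rle_trans (Rabs_triang _ _) _; rewrite Rabs_Ropp (Rabs_pos_eq (Y * s)); lra.
by rewrite /Rmin; case: Rle_dec => _; lra.
Qed.

End Estimates.

(** * Assembly of the asymptotic formula *)

Theorem theorem1p5
  (r m k : nat -> nat)
  (K : forall n : nat, {set {set 'I_n}})
  (Hr : forall n, leq 3 (r n))
  (* m = o(r^{-3} n^{3/2}) *)
  (Hm : forall eps, 0 < eps -> exists N0 : nat, forall n : nat, leq N0 n ->
          INR (m n) * INR (r n) ^ 3 <= eps * (INR n * sqrt (INR n)))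
  (* k = o(n^3 / (r^6 m^2)) *)
  (Hk : forall eps, 0 < eps -> exists N0 : nat, forall n : nat, leq N0 n ->
          INR (k n) * INR (r n) ^ 6 * INR (m n) ^ 2 <= eps * INR n ^ 3)
  (HKr : forall n, is_rgraph n (r n) (K n))
  (HKlin : forall n, is_linear n (K n))
  (HKk : forall n, #|K n| = k n) :
  exists C : R, exists N0 : nat, forall n : nat, leq N0 n ->
    exists delta : R,
      Rabs delta <= C * (INR (r n) ^ 4 * INR (k n) / INR n ^ 2
          + Rmin (INR (r n) ^ 6 * INR (m n) ^ 2 * INR (k n) / INR n ^ 3)
                 (INR (r n) ^ 5 * INR (m n) * INR (k n) / INR n ^ 2)) /\
      prob_contained n (r n) (m n) (K n) =
        INR (ffall (m n) (k n)) / INR 'C(n, r n) ^ (k n)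
        * exp (INR (ffall (r n) 2) ^ 2 * INR (k n) ^ 2 / (4 * INR n ^ 2) + delta).
Proof.
(* Squaring the bound with [1 / 1000] yields the constant [1 / 1000000] in [dense]. *)
have [N0 HN0] := Hm (1 / 1000) ltac:(lra).
(* The successor forces [n > 0]; the constant is that of [step_parameters]. *)
exists 35, N0.+1 => n Nn.
have {HN0} Hm' := HN0 n (ltnW Nn).
have {Nn} n0 : (0 < n)%N by apply: leq_trans Nn.
have r3 := Hr n; have KL : K n \in Lr n (r n) #|K n|.
  by rewrite inE HKr HKlin eqxx.
have -> : prob_contained n (r n) (m n) (K n) =
    INR #|ext (r n) (K n) (m n)| / INR #|ext (r n) (set0 : {set {set 'I_n}}) (m n)|.
  congr (_ / INR _); apply: eq_card => H.
  by rewrite [RHS]inE sub0set andbT.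
have Kk := HKk n.
rewrite /ffall.
move: (r n) (m n) (k n) (K n) Hm' r3 KL Kk => {}r {}m {}k {}K Hm' r3 KL Kk {Hr Hm Hk HKr HKlin HKk}.
have nu0 : 0 < INR n by apply: lt_0_INR; apply/ltP.
have pos p q : 0 <= p -> 0 <= p / INR n ^ q.
  move=> p0; apply: Rmult_le_pos => //; apply: Rlt_le; apply: Rinv_0_lt_compat.
  exact: pow_lt.
have r0 := pos_INR r; have m0 := pos_INR m; have k0 := pos_INR k.
have ge0 : 0 <= INR r ^ 4 * INR k / INR n ^ 2.
  by apply: pos; apply: Rmult_le_pos => //; apply: pow_le.
have ge1 : 0 <= Rmin (INR r ^ 6 * INR m ^ 2 * INR k / INR n ^ 3)
                 (INR r ^ 5 * INR m * INR k / INR n ^ 2).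
  apply: Rmin_glb; apply: pos; apply: Rmult_le_pos => //; apply: Rmult_le_pos => //;
    exact: pow_le.
(* For [k > m] both sides are zero, as [[m]_k = 0] and no graph with [m] edges contains [K]. *)
have [mk|km] := ltnP m k.
  exists 0; rewrite Rabs_R0; split; first lra.
  by rewrite ffact_small // ext_small ?Kk // /= /Rdiv !Rmult_0_l.
(* The estimates assume [m >= 1]; for [m = 0] also [k = 0], and both sides equal 1. *)
have [mE|mpos] := posnP m.
  move: km; rewrite mE leqn0 => /eqP k_0.
  have K0 : K = set0 by apply: cards0_eq; rewrite Kk.
  have e1 : #|ext r (set0 : {set {set 'I_n}}) 0| = 1%N.
    by have := ext_id KL; rewrite Kk k_0 K0.
  exists 0; rewrite Rabs_R0; split.
    by move: ge0 ge1; rewrite mE; lra.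
  rewrite K0 e1 k_0 ffactn0 /= !(Rmult_0_l, Rmult_0_r) /Rdiv Rmult_0_l Rplus_0_r exp_0.
  by rewrite Rinv_1 !Rmult_1_r.
have dense : INR m ^ 2 * INR r ^ 6 <= INR n ^ 3 / 1000000.
  have -> : INR m ^ 2 * INR r ^ 6 = (INR m * INR r ^ 3) ^ 2 by ring.
  have -> : INR n ^ 3 / 1000000 = (1 / 1000 * (INR n * sqrt (INR n))) ^ 2.
    rewrite !Rpow_mult_distr pow2_sqrt; [field | lra].
  apply: pow_incr; split => //.
  by apply: Rmult_le_pos => //; apply: pow_le.
have r1 : (1 < r)%N by apply: leq_trans r3.
have N_gt0 := bin_INR_gt0 r3 mpos dense.
have [asmall step] := step_parameters r3 mpos dense.
set Y := INR (r ^_ 2) ^ 2 / (2 * INR n ^ 2) in step.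
set E := 35 * Rmin _ _ in step.
have L0 : 0 < INR #|ext r (set0 : {set {set 'I_n}}) m|.
  apply: (ext_gt0 r1 N_gt0 asmall) => //; last by rewrite cards0.
  by apply/LrP; split=> // e; rewrite inE.
have Km : (#|K| <= m)%N by rewrite Kk.
have [|delta dl ->] := @ext_product n r m K Y E N_gt0 _ KL Km.
  move=> T e TL eT Tm.
  have [rho [EQ R1 R2]] := ext_ratio r1 N_gt0 asmall TL eT Tm.
  exists rho => //; apply: step => //.
  by split; [exact: pos_INR | apply: INR_leq; exact: ltnW].
rewrite {}Kk in dl *.
(* The product gives [Y k (k - 1) / 2], while the target exponent is [Y k^2 / 2]. The difference
   [Y k / 2] goes into the error and accounts for the term [r^4 k / n^2]. *)
exists (delta - Y * INR k / 2); split.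
- have EE : INR k * E <= 35 * Rmin (INR r ^ 6 * INR m ^ 2 * INR k / INR n ^ 3)
                 (INR r ^ 5 * INR m * INR k / INR n ^ 2).
    rewrite /E.
    set A := _ / INR n ^ 3; set B := _ / INR n ^ 2.
    have -> : INR r ^ 6 * INR m ^ 2 * INR k / INR n ^ 3 = INR k * A.
      by rewrite /A; field; lra.
    have -> : INR r ^ 5 * INR m * INR k / INR n ^ 2 = INR k * B.
      by rewrite /B; field; lra.
    rewrite /Rmin; case: Rle_dec => H1; case: Rle_dec => H2; nra.
  have rr : (INR r * (INR r - 1)) ^ 2 <= INR r ^ 4.
    have -> : INR r ^ 4 = (INR r * INR r) ^ 2 by ring.
    have r3' : 3 <= INR r by have := INR_leq r3; rewrite /=; lra.
    by apply: pow_incr; split; nra.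
  have YY : 0 <= Y * INR k / 2 <= INR r ^ 4 * INR k / INR n ^ 2.
    have -> : Y * INR k / 2 = (INR r * (INR r - 1)) ^ 2 * (INR k / INR n ^ 2) / 4.
      by rewrite /Y ffact2_INR; field; lra.
    have -> : INR r ^ 4 * INR k / INR n ^ 2 = INR r ^ 4 * (INR k / INR n ^ 2).
      by field; lra.
    have kn := pos _ 2%N k0.
    have := Rmult_le_compat_r _ _ _ kn rr.
    have := Rmult_le_pos _ _ (pow2_ge_0 (INR r * (INR r - 1))) kn.
    lra.
  apply: Rle_trans (Rabs_triang _ _) _; rewrite Rabs_Ropp (Rabs_pos_eq (Y * _ / 2)); lra.
- have -> : INR (r ^_ 2) ^ 2 * INR k ^ 2 / (4 * INR n ^ 2) + (delta - Y * INR k / 2) =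
    Y * (INR k * (INR k - 1) / 2) + delta by rewrite /Y; field; lra.
  by field; split; [apply: pow_nonzero; lra | lra].
Qed.
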